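(* Let $S$ be a $\Gamma$-semiring which has a left unity and a right unity, and let $R$ be its right operator semiring. For a fuzzy subset $\sigma$ of $S$ let $\sigma^{*'}$ be the fuzzy subset of $R$ given by $\sigma^{*'}(\sum_i[\alpha_i,x_i])=\inf_{a\in S}\sigma(\sum_i a\alpha_i x_i)$, and for a fuzzy subset $\mu$ of $R$ let $\mu^{*}$ be the fuzzy subset of $S$ given by $\mu^{*}(a)=\inf_{\alpha\in\Gamma}\mu([\alpha,a])$. Then: (1) if $\sigma$ is a fuzzy $h$-ideal of $S$, then $\sigma^{*'}$ is a fuzzy $h$-ideal of $R$; (2) if $\mu$ is a fuzzy $h$-ideal of $R$, then $\mu^{*}$ is a fuzzy $h$-ideal of $S$.
   Context: $\Gamma$-semiring: $S$ and $\Gamma$ are (nonempty) additive commutative semigroups with a map $S\times\Gamma\times S\to S$, $(a,\alpha,b)\mapsto a\alpha b$, such that $a\alpha(b+c)=a\alpha b+a\alpha c$, $(a+b)\alpha c=a\alpha c+b\alpha c$, $a(\alpha+\beta)c=a\alpha c+a\beta c$, $a\alpha(b\beta c)=(a\alpha b)\beta c$ for all $a,b,c\in S$, $\alpha,\beta\in\Gamma$. No zero elements are assumed. Right operator semiring $R$: let $G$ be the free additive commutative semigroup generated by $\Gamma\times S$ (finite nonempty formal sums). Identify $\sum_i(\alpha_i,x_i)$ with $\sum_j(\beta_j,y_j)$ iff $\sum_i a\alpha_i x_i=\sum_j a\beta_j y_j$ for all $a\in S$; this is a congruence on $G$. The class of $\sum_i(\alpha_i,x_i)$ is written $\sum_i[\alpha_i,x_i]$.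 $R$ is the quotient, with the induced addition and the multiplication $(\sum_i[\alpha_i,x_i])(\sum_j[\beta_j,y_j])=\sum_{i,j}[\alpha_i,x_i\beta_j y_j]$; it is a semiring. Unities: a right unity of $S$ is a finite sum $\sum_j[\gamma_j,f_j]\in R$ with $\sum_j a\gamma_j f_j=a$ for all $a\in S$. A left unity of $S$ is given by finitely many $e_i\in S$, $\delta_i\in\Gamma$ with $\sum_i e_i\delta_i a=a$ for all $a\in S$. A fuzzy subset of a set $X$ is a function $X\to[0,1]$. A fuzzy subset $\mu$ of $S$ is a fuzzy ideal of $S$ if $\mu(a+b)\ge\min(\mu(a),\mu(b))$, $\mu(a\alpha b)\ge\mu(a)$ and $\mu(a\alpha b)\ge\mu(b)$ for all $a,b\in S$, $\alpha\in\Gamma$. A fuzzy subset $\mu$ of $R$ is a fuzzy ideal of $R$ if $\mu(p+q)\ge\min(\mu(p),\mu(q))$, $\mu(pq)\ge\mu(p)$ and $\mu(pq)\ge\mu(q)$ for all $p,q\in R$. A fuzzy ideal $\mu$ (of $S$ or of $R$) is a fuzzy $h$-ideal if for all $x,z,y_1,y_2$ (in $S$, respectively in $R$), $x+y_1+z=y_2+z$ implies $\mu(x)\ge\min(\mu(y_1),\mu(y_2))$. *)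

(* Defs.v *)
From HB Require Import structures.
From mathcomp Require Import all_boot all_order all_algebra.
From mathcomp Require Import generic_quotient finmap multiset.
From mathcomp Require Import boolp classical_sets reals.

Set Implicit Arguments.
Unset Strict Implicit.
Unset Printing Implicit Defensive.

Local Open Scope mset_scope.
Local Open Scope quotient_scope.
Local Open Scope ring_scope.

(* addSemigroupType is the library's structure of additive *commutative*
   semigroups; it has no zero, hence no \sum. [sumne d s] is the sum of a
   nonempty sequence [s]; the default [d] is only returned on [::]. *)
Definition sumne (V : addSemigroupType) (d : V) (s : seq V) : V :=
  if s is x :: s' then foldl +%R x s' else d.

Section Sumne.
Variable V : addSemigroupType.
Implicit Types (d x : V) (s t : seq V).

Local Notation oadd := (oAC (@Algebra.addrA V) (@Algebra.addrC V)).

Lemma some_sumne d s : s != [::] ->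
  Some (sumne d s) = \big[oadd/None]_(x <- s) Some x.
Proof.
case: s => // x s _; elim/last_ind: s => [|s y IHs] /=; first by rewrite big_seq1.
by rewrite foldl_rcons -rcons_cons -cats1 big_cat /= -IHs big_seq1 oACE.
Qed.

Lemma sumne_dflt d d' s : s != [::] -> sumne d s = sumne d' s.
Proof. by case: s. Qed.

Lemma perm_sumne d s t : perm_eq s t -> sumne d s = sumne d t.
Proof.
move=> st; have [s0|s0] := eqVneq s [::].
  by move: st; rewrite s0 perm_sym => /perm_nilP ->.
have t0 : t != [::].
  by apply: contra_neq s0 => t0; move: st; rewrite t0 => /perm_nilP.
by apply: Some_inj; rewrite !some_sumne //; apply: perm_big.
Qed.

Lemma sumne_cat d s t : s != [::] -> t != [::] ->
  sumne d (s ++ t) = sumne d s + sumne d t.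
Proof.
move=> s0 t0; apply: Some_inj; rewrite some_sumne; last by case: (s) s0.
by rewrite big_cat /= -!(some_sumne d) // oACE.
Qed.

Lemma sumne_cons d x s : s != [::] -> sumne d (x :: s) = x + sumne d s.
Proof. by move=> s0; rewrite -cat1s sumne_cat. Qed.

End Sumne.

Lemma map_neq0 (T U : eqType) (f : T -> U) s : (map f s != [::]) = (s != [::]).
Proof. by case: s. Qed.

Lemma sumne_morph (T : eqType) (U V : addSemigroupType) (f : U -> V)
    (g : T -> U) d d' (s : seq T) :
  {morph f : x y / x + y} -> s != [::] ->
  f (sumne d [seq g x | x <- s]) = sumne d' [seq f (g x) | x <- s].
Proof.
move=> fD; elim: s => // x [//|y s] IHs _.
by rewrite !(map_cons _ x) (sumne_cons _ (g x)) // (sumne_cons _ (f (g x))) // fD IHs.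
Qed.

Lemma sumneD (T : eqType) (V : addSemigroupType) (f g : T -> V) d (s : seq T) :
  s != [::] ->
  sumne d [seq f x + g x | x <- s] =
  sumne d [seq f x | x <- s] + sumne d [seq g x | x <- s].
Proof.
elim: s => // x [//|y s] IHs _.
rewrite !(map_cons _ x) (sumne_cons _ (f x + g x)) // (sumne_cons _ (f x)) //.
by rewrite (sumne_cons _ (g x)) // IHs // Algebra.addrACA.
Qed.

Lemma exchange_sumne (T U : eqType) (V : addSemigroupType) (f : T -> U -> V)
    d d' (s : seq T) (t : seq U) : s != [::] -> t != [::] ->
  sumne d [seq f x y | x <- s, y <- t] =
  sumne d' [seq sumne d [seq f x y | x <- s] | y <- t].
Proof.
move=> s0 t0; rewrite (@sumne_dflt _ d' d) ?map_neq0 //.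
elim: s s0 => // x [_ _|x' s IHs _].
  by rewrite /= cats0.
rewrite allpairs_cons sumne_cat ?map_neq0 //; last by case: (t) t0.
rewrite IHs // -sumneD //; congr (sumne d _).
by apply: eq_map => y; rewrite [in RHS]map_cons sumne_cons.
Qed.

Record gammaSemiring (S G : addSemigroupType) := GammaSemiring {
  gmul :> S -> G -> S -> S;
  gammaSemiring_S_nonempty : inhabited S;
  gammaSemiring_G_nonempty : inhabited G;
  gmulDr : forall a al b c, gmul a al (b + c) = gmul a al b + gmul a al c;
  gmulDl : forall a b al c, gmul (a + b) al c = gmul a al c + gmul b al c;
  gmulDm : forall a al be c, gmul a (al + be) c = gmul a al c + gmul a be c;
  gmulA : forall a al b be c, gmul a al (gmul b be c) = gmul (gmul a al b) be c
}.

(* The free additive commutative semigroup on T: nonempty finite multisets. *)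
Definition formalSum (T : choiceType) := {m : {mset T} | m != mset0}.

HB.instance Definition _ (T : choiceType) := Choice.on (formalSum T).

Section FormalSum.
Variable T : choiceType.
Implicit Types (x : T) (m n : formalSum T).

Lemma formalSum_neq0 m : (val m : seq T) != [::].
Proof.
apply: contraNneq (valP m) => m0; apply/eqP/msetP => x.
by rewrite mset0E -count_mem_mset m0.
Qed.

Lemma formal_gen_subproof x : [mset x] != mset0.
Proof. by apply/eqP => /msetP/(_ x); rewrite msetnxx mset0E. Qed.

Definition formal_gen x : formalSum T := exist _ [mset x] (formal_gen_subproof x).

Lemma formal_add_subproof m n : val m `+` val n != mset0.
Proof.
apply: contraNneq (valP m) => /msetP mn0; apply/eqP/msetP => x.
by move: (mn0 x); rewrite msetE2 mset0E => /eqP; rewrite addn_eq0 => /andP[/eqP].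
Qed.

Definition formal_add m n : formalSum T :=
  exist _ (val m `+` val n) (formal_add_subproof m n).

Lemma formal_addC : commutative formal_add.
Proof. by move=> m n; apply: val_inj; rewrite /= msetDC. Qed.

Lemma formal_addA : associative formal_add.
Proof. by move=> m n p; apply: val_inj; rewrite /= msetDA. Qed.

HB.instance Definition _ :=
  Algebra.isAddSemigroup.Build (formalSum T) formal_addC formal_addA.

End FormalSum.

Section RightOperatorSemiring.
Variables (S G : addSemigroupType) (M : gammaSemiring S G).

Local Notation FS := (formalSum (G * S)%type).
Implicit Types (a b x : S) (al : G) (m n : FS).

Definition formal_eval a m : S := sumne a [seq M a p.1 p.2 | p <- val m].

(* (sum_i (al_i, x_i)) (sum_j (be_j, y_j)) = sum_(i, j) (al_i, x_i be_j y_j) *)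
Definition formal_mul_mset m n : {mset G * S} :=
  seq_mset [seq (p.1, M p.2 q.1 q.2) | p <- val m, q <- val n].

Lemma formal_mul_subproof m n : formal_mul_mset m n != mset0.
Proof.
have := formalSum_neq0 m; have := formalSum_neq0 n.
rewrite /formal_mul_mset.
case: (enum_mset (val n)) => // q t _; case: (enum_mset (val m)) => // p s _ /=.
apply/eqP => /msetP/(_ (p.1, M p.2 q.1 q.2)).
by rewrite mset_seqE mset0E /= eqxx.
Qed.

Definition formal_mul m n : FS :=
  exist _ (formal_mul_mset m n) (formal_mul_subproof m n).

Lemma formal_eval_gen a al x : formal_eval a (formal_gen (al, x)) = M a al x.
Proof. by rewrite /formal_eval /= enum_msetn. Qed.

Lemma formal_evalD a m n :
  formal_eval a (m + n) = formal_eval a m + formal_eval a n.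
Proof.
rewrite /formal_eval -sumne_cat ?map_neq0 ?formalSum_neq0 // -map_cat.
apply/perm_sumne/perm_map/allP => p _ /=.
by rewrite count_cat !count_mem_mset msetE2.
Qed.

Lemma formal_eval_mul a m n :
  formal_eval a (formal_mul m n) = formal_eval (formal_eval a m) n.
Proof.
rewrite {1}/formal_eval (perm_sumne a (perm_map _ (perm_eq_seq_mset _))).
rewrite map_allpairs /= (exchange_sumne _ _ (formal_eval a m)) ?formalSum_neq0 //.
congr sumne; apply: eq_map => q.
rewrite [in RHS]/formal_eval (sumne_morph (f := fun b => M b q.1 q.2) _ _ a).
- by congr sumne; apply: eq_map => p /=; rewrite gmulA.
- by move=> b c; rewrite gmulDl.
- exact: formalSum_neq0.
Qed.

Lemma formal_eval_addl a b m :
  formal_eval (a + b) m = formal_eval a m + formal_eval b m.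
Proof.
have m0 := formalSum_neq0 m.
rewrite /formal_eval (@sumne_dflt _ b a) ?map_neq0 // -sumneD //.
rewrite (@sumne_dflt _ _ a) ?map_neq0 //; congr sumne.
by apply: eq_map => p; rewrite gmulDl.
Qed.

Definition formal_eqv m n : bool :=
  `[< forall a, formal_eval a m = formal_eval a n >].

Lemma formal_eqv_is_equiv : equiv_class_of formal_eqv.
Proof.
split=> [m|m n|n m p].
- exact/asboolP.
- by apply/asboolP/asboolP => mn a; rewrite mn.
- by move=> /asboolP mn /asboolP np; apply/asboolP => a; rewrite mn np.
Qed.

Canonical formal_eqv_equiv := EquivRelPack formal_eqv_is_equiv.

Definition rightOp := {eq_quot formal_eqv}.

HB.instance Definition _ := Choice.on rightOp.
HB.instance Definition _ := EqQuotient.on rightOp.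

Implicit Types p q r : rightOp.

(* [formal_class m] is the class of m, [bracket al x] is the class [al, x]. *)
Definition formal_class m : rightOp := \pi_rightOp m.
Definition bracket al x : rightOp := formal_class (formal_gen (al, x)).

(* The value sum_i a al_i x_i, for p = sum_i [al_i, x_i]; it does not depend on
   the representative, see [act_class]. *)
Definition act a p : S := formal_eval a (repr p).
Definition rightOp_add p q : rightOp := formal_class (repr p + repr q).
Definition rightOp_mul p q : rightOp := formal_class (formal_mul (repr p) (repr q)).

Lemma act_class a m : act a (formal_class m) = formal_eval a m.
Proof.
by have /eqmodP/asboolP := reprK (formal_class m); apply.
Qed.

Lemma act_inj p q : (forall a, act a p = act a q) -> p = q.
Proof. by move=> pq; rewrite -[p]reprK -[q]reprK; apply/eqmodP/asboolP. Qed.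

Lemma formal_classP m n :
  formal_class m = formal_class n <->
  forall a, formal_eval a m = formal_eval a n.
Proof. by split=> [mn a|mn]; [rewrite -!act_class mn|exact/eqmodP/asboolP]. Qed.

Lemma act_bracket a al x : act a (bracket al x) = M a al x.
Proof. by rewrite act_class formal_eval_gen. Qed.

Lemma act_rightOp_add a p q : act a (rightOp_add p q) = act a p + act a q.
Proof. by rewrite act_class formal_evalD. Qed.

Lemma act_mul a p q : act a (rightOp_mul p q) = act (act a p) q.
Proof. by rewrite act_class formal_eval_mul. Qed.

Lemma act_addl a b p : act (a + b) p = act a p + act b p.
Proof. exact: formal_eval_addl. Qed.

Lemma rightOp_addC : commutative rightOp_add.
Proof. by move=> p q; apply: act_inj => a; rewrite !act_rightOp_add Algebra.addrC. Qed.

Lemma rightOp_addA : associative rightOp_add.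
Proof. by move=> p q r; apply: act_inj => a; rewrite !act_rightOp_add Algebra.addrA. Qed.

HB.instance Definition _ :=
  Algebra.isAddSemigroup.Build rightOp rightOp_addC rightOp_addA.

Lemma actD a p q : act a (p + q) = act a p + act a q.
Proof. exact: act_rightOp_add. Qed.

Lemma formal_classD m n :
  formal_class (m + n) = formal_class m + formal_class n.
Proof. by apply: act_inj => a; rewrite actD !act_class formal_evalD. Qed.

Lemma formal_classM m n :
  formal_class (formal_mul m n) = rightOp_mul (formal_class m) (formal_class n).
Proof. by apply: act_inj => a; rewrite act_mul !act_class formal_eval_mul. Qed.

Lemma rightOp_mulA : associative rightOp_mul.
Proof. by move=> p q r; apply: act_inj => a; rewrite !act_mul. Qed.

Lemma rightOp_mulDl : left_distributive rightOp_mul +%R.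
Proof. by move=> p q r; apply: act_inj => a; rewrite actD !act_mul actD act_addl. Qed.

Lemma rightOp_mulDr : right_distributive rightOp_mul +%R.
Proof. by move=> p q r; apply: act_inj => a; rewrite actD !act_mul actD. Qed.

Definition is_right_unity (f : rightOp) : Prop := forall a, act a f = a.

(* s lists the pairs (e_i, delta_i). *)
Definition is_left_unity (s : seq (S * G)) : Prop :=
  s != [::] /\ forall a, sumne a [seq M ed.1 ed.2 a | ed <- s] = a.

Definition has_right_unity : Prop := exists f, is_right_unity f.
Definition has_left_unity : Prop := exists s, is_left_unity s.

End RightOperatorSemiring.

Section Fuzzy.
Variable K : realType.

Definition fuzzy_subset (X : Type) (mu : X -> K) : Prop :=
  forall x, 0 <= mu x <= 1.

Definition fuzzy_h_condition (X : addSemigroupType) (mu : X -> K) : Prop :=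
  forall x z y1 y2, x + y1 + z = y2 + z -> Num.min (mu y1) (mu y2) <= mu x.

Variables (S G : addSemigroupType) (M : gammaSemiring S G).

Definition fuzzy_ideal (mu : S -> K) : Prop :=
  [/\ fuzzy_subset mu,
      forall a b, Num.min (mu a) (mu b) <= mu (a + b),
      forall a al b, mu a <= mu (M a al b)
    & forall a al b, mu b <= mu (M a al b)].

Definition fuzzy_h_ideal (mu : S -> K) : Prop :=
  fuzzy_ideal mu /\ fuzzy_h_condition mu.

Definition rightOp_fuzzy_ideal (mu : rightOp M -> K) : Prop :=
  [/\ fuzzy_subset mu,
      forall p q, Num.min (mu p) (mu q) <= mu (p + q),
      forall p q, mu p <= mu (rightOp_mul p q)
    & forall p q, mu q <= mu (rightOp_mul p q)].

Definition rightOp_fuzzy_h_ideal (mu : rightOp M -> K) : Prop :=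
  rightOp_fuzzy_ideal mu /\ fuzzy_h_condition mu.

Local Open Scope classical_set_scope.

Definition to_rightOp (sigma : S -> K) (p : rightOp M) : K :=
  inf [set sigma (act a p) | a in [set: S]].

Definition of_rightOp (mu : rightOp M -> K) (a : S) : K :=
  inf [set mu (bracket M al a) | al in [set: G]].

End Fuzzy.

(* Main.v *)
Require Import Defs.
From mathcomp Require Import all_boot all_order all_algebra reals.
From mathcomp Require Import classical_sets.

(** Both claims follow pointwise, by comparing infima, from the identities
    [a(pq) = (ap)q], [a(p + q) = ap + aq], [[al, a + b] = [al, a] + [al, b]] and
    [[al, a be b] = [al, a][be, b]]. The one inequality involving a sum is
    [sigma (b p) >= sigma b], where [b p] is a finite nonempty sum of elements
    [b al x], each of membership at least [sigma b]. *)

Set Implicit Arguments.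
Unset Strict Implicit.
Unset Printing Implicit Defensive.

Import Order.TTheory.
Local Open Scope classical_set_scope.
Local Open Scope ring_scope.

Section FuzzyInf.
Variables (K : realType) (T : Type) (f : T -> K).

(** Inhabitedness excludes the empty range, on which [inf] takes the default value 0. *)
Lemma le_inf_range (c : K) : inhabited T -> (forall x, c <= f x) ->
  c <= inf [set f x | x in [set: T]].
Proof.
move=> [x0] cf; apply: lb_le_inf; first by exists (f x0), x0.
by move=> _ [x _ <-].
Qed.

Lemma fuzzy_inf_range_le (x : T) : fuzzy_subset f ->
  inf [set f x | x in [set: T]] <= f x.
Proof.
move=> f01; apply: ge_inf; last by exists x.
(* Memberships are nonnegative, so 0 bounds the range below. *)
by exists 0 => _ [y _ <-]; case/andP: (f01 y).
Qed.

Lemma fuzzy_inf_range_itv : inhabited T -> fuzzy_subset f ->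
  0 <= inf [set f x | x in [set: T]] <= 1.
Proof.
move=> T0 f01; apply/andP; split.
  by apply: le_inf_range => // x; case/andP: (f01 x).
case: T0 => x; apply: le_trans (fuzzy_inf_range_le x f01) _.
by case/andP: (f01 x).
Qed.

End FuzzyInf.

Lemma le_min2 (K : realType) (a b c d : K) :
  a <= c -> b <= d -> Num.min a b <= Num.min c d.
Proof. by move=> ac bd; rewrite le_min !ge_min ac bd orbT. Qed.

Lemma le_sumne (K : realType) (V : addSemigroupType) (mu : V -> K) (c : K)
    (T : eqType) (g : T -> V) (d : V) (s : seq T) :
  (forall a b, Num.min (mu a) (mu b) <= mu (a + b)) ->
  s != [::] -> (forall x, c <= mu (g x)) ->
  c <= mu (sumne d [seq g x | x <- s]).
Proof.
(* With no zero to start from, the induction begins at one-term sums; the default [d] is never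
   reached. *)
move=> muD + cg; elim: s => // x [|y s] IHs _; first exact: cg.
rewrite map_cons sumne_cons //; apply: le_trans (muD _ _).
by rewrite le_min cg IHs.
Qed.

Section OperatorSemiring.
Variables (S G : addSemigroupType) (M : gammaSemiring S G).

(** Elements of [rightOp M] are determined by their action on [S], which reduces the identity to
    distributivity in [S]. *)
Lemma bracketDr al (a b : S) : bracket M al (a + b) = bracket M al a + bracket M al b.
Proof. by apply: act_inj => c; rewrite actD !act_bracket gmulDr. Qed.

Lemma bracket_gmul al (a : S) be (b : S) :
  bracket M al (M a be b) = rightOp_mul (bracket M al a) (bracket M be b).
Proof. by apply: act_inj => c; rewrite act_mul !act_bracket gmulA. Qed.

Variable K : realType.

Lemma fuzzy_ideal_act (sigma : S -> K) (a : S) (p : rightOp M) :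
  fuzzy_ideal M sigma -> sigma a <= sigma (act a p).
Proof.
by case=> _ sD sMl _; apply: le_sumne => //; apply: formalSum_neq0.
Qed.

Lemma to_rightOp_fuzzy_h_ideal (sigma : S -> K) :
  fuzzy_h_ideal M sigma -> rightOp_fuzzy_h_ideal (to_rightOp (M := M) sigma).
Proof.
move=> [sI sH]; have [s01 sD _ _] := sI; have S0 := gammaSemiring_S_nonempty M.
have le_act a (p : rightOp M) : to_rightOp sigma p <= sigma (act a p).
  exact: fuzzy_inf_range_le (fun x => sigma (act x p)) a (fun x => s01 _).
split; first split.
- by move=> p; apply: fuzzy_inf_range_itv => // a; apply: s01.
- move=> p q; apply: le_inf_range => // a; rewrite actD.
  exact: le_trans (le_min2 (le_act a p) (le_act a q)) (sD _ _).
- move=> p q; apply: le_inf_range => // a; rewrite act_mul.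
  exact: le_trans (le_act a p) (fuzzy_ideal_act _ _ sI).
(* [sigma (act (act a p) q)] is itself a member of the family defining [to_rightOp sigma q], taken
   at the point [act a p]. *)
- by move=> p q; apply: le_inf_range => // a; rewrite act_mul.
- move=> x z y1 y2 E; apply: le_inf_range => // a.
  apply: le_trans (le_min2 (le_act a y1) (le_act a y2)) _.
  (* Acting on [a] carries the equation [E] to [S], with [act a z] as the common summand. *)
  by apply: (sH _ (act a z)); rewrite -!actD E.
Qed.

Lemma of_rightOp_fuzzy_h_ideal (mu : rightOp M -> K) :
  rightOp_fuzzy_h_ideal mu -> fuzzy_h_ideal M (of_rightOp mu).
Proof.
move=> [[m01 mD mMl mMr] mH]; have G0 := gammaSemiring_G_nonempty M.
have le_br al a : of_rightOp mu a <= mu (bracket M al a).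
  exact: fuzzy_inf_range_le (fun be => mu (bracket M be a)) al (fun _ => m01 _).
split; first split.
- by move=> a; apply: fuzzy_inf_range_itv => // al; apply: m01.
- move=> a b; apply: le_inf_range => // al; rewrite bracketDr.
  exact: le_trans (le_min2 (le_br al a) (le_br al b)) (mD _ _).
- move=> a be b; apply: le_inf_range => // al; rewrite bracket_gmul.
  exact: le_trans (le_br al a) (mMl _ _).
- move=> a be b; apply: le_inf_range => // al; rewrite bracket_gmul.
  exact: le_trans (le_br be b) (mMr _ _).
- move=> x z y1 y2 E; apply: le_inf_range => // al.
  apply: le_trans (le_min2 (le_br al y1) (le_br al y2)) _.
  (* Additivity of the bracket carries [E] to [rightOp M]. *)
  by apply: (mH _ (bracket M al z)); rewrite -!bracketDr E.
Qed.

End OperatorSemiring.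

Theorem proposition3p10 (K : realType) (S G : addSemigroupType)
    (M : gammaSemiring S G)
    (hleft : has_left_unity M) (hright : has_right_unity M) :
  (forall sigma : S -> K,
     fuzzy_h_ideal M sigma -> rightOp_fuzzy_h_ideal (to_rightOp (M := M) sigma))
  /\
  (forall mu : rightOp M -> K,
     rightOp_fuzzy_h_ideal mu -> fuzzy_h_ideal M (of_rightOp mu)).
Proof.
by split; [apply: to_rightOp_fuzzy_h_ideal | apply: of_rightOp_fuzzy_h_ideal].
Qed.
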